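(* (In affine logic.) Let $\sqsubseteq$ be a refutative linear order on a type $A$, with induced equality $(x\circeq y):=(x\sqsubseteq y)\sqcap(y\sqsubseteq x)$, and write $(x\sqsubset y):=(y\sqsubseteq x)^\perp$ and $(x\not\circeq y):=(x\circeq y)^\perp$. Then for $x,y:A$ \begin{align*} (x\sqsubset y)&\equiv(x\sqsubseteq y)\boxtimes(x\not\circeq y),\\ (x\sqsubseteq y)&\equiv(x\circeq y)\odot(x\sqsubset y). \end{align*}
   Context: Affine logic is classical (involutive-negation) linear logic together with the weakening rule. Its connectives are: multiplicative conjunction $\boxtimes$ (usually $\otimes$) and disjunction $\odot$ (''par''), additive conjunction $\sqcap$ (usually $\&$) and disjunction $\sqcup$ (usually $\oplus$), linear implication $\multimap$, involutive linear negation $(-)^\perp$, units $\top,\bot$, and exponentials $!,?$, with the usual rules; in particular $P\odot Q=(P^\perp\boxtimes Q^\perp)^\perp$, $P\sqcup Q=(P^\perp\sqcap Q^\perp)^\perp$, $(P\multimap Q)=(P^\perp\odot Q)$, $?P=(!(P^\perp))^\perp$, and $\top$ is the unit of both $\boxtimes$ and $\sqcap$. Predicates depend on variables ranging over types. $\vdash$ is derivability and $\equiv$ is mutual derivability. (Algebraically: predicates on each type form a semicartesian $\ast$-autonomous category/poset with finite products and a Seely comonad $!$.) A preorder on a type $A$ is a predicate $\sqsubseteq$ on $A\times A$ with $\vdash_{x:A}x\sqsubseteq x$ and $(x\sqsubseteq y)\boxtimes(y\sqsubseteq z)\vdash_{x,y,z:A}x\sqsubseteq z$. A linear order is a preorder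 with $\vdash_{x,y:A}(x\sqsubseteq y)\odot(y\sqsubseteq x)$. A proposition or predicate $P$ is refutative if $P\equiv\,?P$; the order is refutative if the predicate $\sqsubseteq$ is. *)

(* Defs.v *)
From Stdlib Require Export List Permutation.
Export ListNotations.

(** First-order many-sorted affine logic: classical linear logic with
    weakening, over an arbitrary signature and an arbitrary theory. *)

Set Implicit Arguments.
Unset Strict Implicit.
Unset Printing Implicit Defensive.

Record signature : Type := Signature {
  sort : Type;
  fsym : Type;
  fdom : fsym -> list sort;
  fcod : fsym -> sort;
  psym : Type;
  pdom : psym -> list sort
}.

(** The context [x0 : A0, x1 : A1, ...] is the list [A0; A1; ...]. *)
Definition ctx (Sg : signature) : Type := list (sort Sg).

(** Well-typed de Bruijn indices: [vz] is the variable at the head. *)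
Inductive var (Sg : signature) : ctx Sg -> sort Sg -> Type :=
| vz : forall G s, var (s :: G) s
| vs : forall G s r, var G s -> var (r :: G) s.
Arguments vz {Sg G s}.
Arguments vs {Sg G s r} _.

(** The arguments of a symbol are indexed by the positions in its arity. *)
Inductive term (Sg : signature) (G : ctx Sg) : sort Sg -> Type :=
| Var : forall s, var G s -> term G s
| App : forall f : fsym Sg,
    (forall s, var (fdom f) s -> term G s) -> term G (fcod f).
Arguments Var {Sg G s} _.
Arguments App {Sg G} f _.

(** A [subst D G] assigns a term in context [G] to each variable of [D]. *)
Definition subst (Sg : signature) (D G : ctx Sg) : Type :=
  forall s, var D s -> term G s.

Definition snil (Sg : signature) (G : ctx Sg) : subst [] G :=
  fun s v =>
    match v in var L r return
      match L with [] => term G r | _ => unit end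
    with
    | vz => tt
    | vs _ => tt
    end.

Definition scons (Sg : signature) (D G : ctx Sg) (a : sort Sg)
    (t : term G a) (f : subst D G) : subst (a :: D) G :=
  fun s v =>
    match v in var L r return
      match L with
      | [] => unit
      | b :: K => term G b -> subst K G -> term G r
      end
    with
    | vz => fun u _ => u
    | vs w => fun _ g => g _ w
    end t f.

Fixpoint tsubst (Sg : signature) (D G : ctx Sg) (f : subst D G)
    (s : sort Sg) (t : term D s) : term G s :=
  match t with
  | Var v => f _ v
  | App h args => App h (fun r v => tsubst f (args r v))
  end.

Definition sid (Sg : signature) (G : ctx Sg) : subst G G :=
  fun s v => Var v.

Definition sshift (Sg : signature) (G : ctx Sg) (a : sort Sg) :
    subst G (a :: G) :=
  fun s v => Var (vs v).

Definition slift (Sg : signature) (D G : ctx Sg) (a : sort Sg)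
    (f : subst D G) : subst (a :: D) (a :: G) :=
  scons (Var vz) (fun s v => tsubst (@sshift Sg G a) (f s v)).

Inductive form (Sg : signature) (G : ctx Sg) : Type :=
| Atom : forall p : psym Sg, subst (pdom p) G -> form G
| Top : form G
| Neg : form G -> form G
| Tensor : form G -> form G -> form G
| With : form G -> form G -> form G
| Bang : form G -> form G
| All : forall a : sort Sg, form (a :: G) -> form G.
Arguments Atom {Sg G} p _.
Arguments Top {Sg G}.

Section Connectives.
Variables (Sg : signature) (G : ctx Sg).
Implicit Types P Q : form G.

Definition Bot : form G := Neg Top.
Definition Par P Q : form G := Neg (Tensor (Neg P) (Neg Q)).
Definition Plus P Q : form G := Neg (With (Neg P) (Neg Q)).
Definition Limp P Q : form G := Par (Neg P) Q.
Definition Whynot P : form G := Neg (Bang (Neg P)).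
Definition Ex (a : sort Sg) (P : form (a :: G)) : form G :=
  Neg (All (Neg P)).
End Connectives.
Arguments Bot {Sg G}.

Declare Scope affine_scope.
Delimit Scope affine_scope with aff.
Bind Scope affine_scope with form.

Notation "P ^⊥" := (Neg P) (at level 7, left associativity, format "P ^⊥")
  : affine_scope.
Notation "P ⊠ Q" := (Tensor P Q) (at level 40, left associativity)
  : affine_scope.
Notation "P ⊓ Q" := (With P Q) (at level 40, left associativity)
  : affine_scope.
Notation "P ⊙ Q" := (Par P Q) (at level 50, left associativity)
  : affine_scope.
Notation "P ⊔ Q" := (Plus P Q) (at level 50, left associativity)
  : affine_scope.
Notation "P ⊸ Q" := (Limp P Q) (at level 55, right associativity)
  : affine_scope.

Fixpoint fsubst (Sg : signature) (D G : ctx Sg) (f : subst D G)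
    (P : form D) : form G :=
  match P in form _ return form G with
  | Atom p args => Atom p (fun s v => tsubst f (args s v))
  | Top => Top
  | Neg P1 => Neg (fsubst f P1)
  | Tensor P1 P2 => Tensor (fsubst f P1) (fsubst f P2)
  | With P1 P2 => With (fsubst f P1) (fsubst f P2)
  | Bang P1 => Bang (fsubst f P1)
  | All P1 => All (fsubst (slift f) P1)
  end.

(** The non-logical axioms of a theory: a set of sequents in context. *)
Definition theory (Sg : signature) : Type :=
  forall G : ctx Sg, list (form G) -> list (form G) -> Prop.

(** [derivable T L M]: the two-sided sequent [L ⊢ M] in context [G].  The
    left side is read as a multiplicative conjunction [⊠] and the right side
    as a multiplicative disjunction [⊙].  Contraction is available only for
    [!]; its dual for [?] follows since [?P] is [(!(P^⊥))^⊥], and likewise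
    the rules for the other defined connectives. *)
Inductive derivable (Sg : signature) (T : theory Sg) :
    forall G : ctx Sg, list (form G) -> list (form G) -> Prop :=
| d_axiom : forall G (L M : list (form G)), T G L M -> derivable T L M
| d_subst : forall D G (f : subst D G) (L M : list (form D)),
    derivable T L M -> derivable T (map (fsubst f) L) (map (fsubst f) M)
| d_id : forall G (P : form G), derivable T [P] [P]
| d_cut : forall G (P : form G) L M L' M',
    derivable T L (P :: M) -> derivable T (P :: L') M' ->
    derivable T (L ++ L') (M ++ M')
| d_exch : forall G (L L' M M' : list (form G)),
    Permutation L L' -> Permutation M M' ->
    derivable T L M -> derivable T L' M'
| d_weakL : forall G (P : form G) L M,
    derivable T L M -> derivable T (P :: L) M
| d_weakR : forall G (P : form G) L M,
    derivable T L M -> derivable T L (P :: M)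
| d_topR : forall G, derivable T [] [@Top Sg G]
| d_negL : forall G (P : form G) L M,
    derivable T L (P :: M) -> derivable T (Neg P :: L) M
| d_negR : forall G (P : form G) L M,
    derivable T (P :: L) M -> derivable T L (Neg P :: M)
| d_tensorL : forall G (P Q : form G) L M,
    derivable T (P :: Q :: L) M -> derivable T (Tensor P Q :: L) M
| d_tensorR : forall G (P Q : form G) L M L' M',
    derivable T L (P :: M) -> derivable T L' (Q :: M') ->
    derivable T (L ++ L') (Tensor P Q :: M ++ M')
| d_withL1 : forall G (P Q : form G) L M,
    derivable T (P :: L) M -> derivable T (With P Q :: L) M
| d_withL2 : forall G (P Q : form G) L M,
    derivable T (Q :: L) M -> derivable T (With P Q :: L) M
| d_withR : forall G (P Q : form G) L M,
    derivable T L (P :: M) -> derivable T L (Q :: M) ->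
    derivable T L (With P Q :: M)
| d_derelict : forall G (P : form G) L M,
    derivable T (P :: L) M -> derivable T (Bang P :: L) M
| d_contract : forall G (P : form G) L M,
    derivable T (Bang P :: Bang P :: L) M -> derivable T (Bang P :: L) M
| d_promote : forall G (P : form G) L M,
    derivable T (map (@Bang Sg G) L) (P :: map (@Whynot Sg G) M) ->
    derivable T (map (@Bang Sg G) L) (Bang P :: map (@Whynot Sg G) M)
| d_allL : forall G a (P : form (a :: G)) (t : term G a) L M,
    derivable T (fsubst (scons t (@sid Sg G)) P :: L) M ->
    derivable T (All P :: L) M
| d_allR : forall G a (P : form (a :: G)) L M,
    derivable T (map (fsubst (@sshift Sg G a)) L)
      (P :: map (fsubst (@sshift Sg G a)) M) ->
    derivable T L (All P :: M).

Definition equiv (Sg : signature) (T : theory Sg) (G : ctx Sg)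
    (P Q : form G) : Prop :=
  derivable T [P] [Q] /\ derivable T [Q] [P].

Definition refutative (Sg : signature) (T : theory Sg) (G : ctx Sg)
    (P : form G) : Prop :=
  equiv T P (Whynot P).

(** A predicate on [A × A] is a formula in the context [x : A, y : A], with
    [x] at the head; [rel R t u] is its instance at the terms [t] and [u]. *)
Definition binpred (Sg : signature) (A : sort Sg) : Type := form [A; A].

Section Relations.
Variables (Sg : signature) (A : sort Sg) (R : binpred A) (G : ctx Sg).
Local Open Scope affine_scope.

Definition rel (t u : term G A) : form G :=
  fsubst (scons t (scons u (@snil Sg G))) R.

Definition rel_eq (t u : term G A) : form G := rel t u ⊓ rel u t.
Definition rel_lt (t u : term G A) : form G := (rel u t)^⊥.
Definition rel_neq (t u : term G A) : form G := (rel_eq t u)^⊥.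
End Relations.

Notation "t ⊑[ R ] u" := (rel R t u)
  (at level 35, no associativity) : affine_scope.
Notation "t ≈[ R ] u" := (rel_eq R t u)
  (at level 35, no associativity) : affine_scope.
Notation "t ⊏[ R ] u" := (rel_lt R t u)
  (at level 35, no associativity) : affine_scope.
Notation "t ≉[ R ] u" := (rel_neq R t u)
  (at level 35, no associativity) : affine_scope.

Record preorder (Sg : signature) (T : theory Sg) (A : sort Sg)
    (R : binpred A) : Prop := Preorder {
  preorder_refl :
    let x : term [A] A := Var vz in
    derivable T [] [x ⊑[R] x]%aff;
  preorder_trans :
    let x : term [A; A; A] A := Var vz in
    let y : term [A; A; A] A := Var (vs vz) in
    let z : term [A; A; A] A := Var (vs (vs vz)) in
    derivable T [(x ⊑[R] y) ⊠ (y ⊑[R] z)]%aff [x ⊑[R] z]%aff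
}.

Record linear_order (Sg : signature) (T : theory Sg) (A : sort Sg)
    (R : binpred A) : Prop := LinearOrder {
  linear_order_preorder : preorder T R;
  linear_order_total :
    let x : term [A; A] A := Var vz in
    let y : term [A; A] A := Var (vs vz) in
    derivable T [] [(x ⊑[R] y) ⊙ (y ⊑[R] x)]%aff
}.

(* Main.v *)
Require Import Defs.

(** Write [a] for [x ⊑ y] and [b] for [y ⊑ x].  The two equivalences are then
    [b^⊥ ≡ a ⊠ (a ⊓ b)^⊥] and [a ≡ (a ⊓ b) ⊙ b^⊥]; both hold for
    arbitrary refutative propositions [a], [b] with [⊢ a ⊙ b].

    One half of each comes from weakening alone: in affine logic
    [a, b ⊢ a ⊓ b], and moving formulas across the turnstile turns this into
    [a ⊠ (a ⊓ b)^⊥ ⊢ b^⊥] and into [a ⊢ (a ⊓ b) ⊙ b^⊥]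
    ([tensor_neg_with_entails_neg], [entails_with_par_neg]).

    The other halves have to use a hypothesis twice.  For
    [⊢ b, a ⊠ (a ⊓ b)^⊥], the two factors are proved from [⊢ b, a], which is
    totality, and from [⊢ b, (a ⊓ b)^⊥], which is a projection; each needs its
    own copy of [b].  A refutative formula is a [?]-formula up to equivalence,
    so the two copies can be merged on the right ([refutative_contractR]).
    The remaining half is the same argument with [a] as the merged formula. *)

Set Implicit Arguments.
Unset Strict Implicit.
Unset Printing Implicit Defensive.

Local Open Scope affine_scope.

Section AffineSequents.
Variables (Sg : signature) (T : theory Sg) (G : ctx Sg).
Implicit Types (a b P Q : form G) (L M : list (form G)).

Lemma exchL P Q L M :
  derivable T (P :: Q :: L) M -> derivable T (Q :: P :: L) M.
Proof. apply d_exch; [apply perm_swap | reflexivity]. Qed.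

Lemma exchR P Q L M :
  derivable T L (P :: Q :: M) -> derivable T L (Q :: P :: M).
Proof. apply d_exch; [reflexivity | apply perm_swap]. Qed.

(** Contraction on the right is inherited from [?P], and for [?P] it is
    contraction of [!(P^⊥)] seen from the other side of the turnstile. *)
Lemma refutative_contractR P L M :
  refutative T P -> derivable T L (P :: P :: M) -> derivable T L (P :: M).
Proof.
  intros [_ whynot_P] H.
  assert (contracted : derivable T L (Whynot P :: M)).
  { apply d_negR, d_contract, d_derelict, exchL, d_derelict.
    now apply d_negL, d_negL. }
  refine (d_exch _ _ (d_cut contracted whynot_P)).
  - now rewrite app_nil_r.
  - symmetry; apply Permutation_cons_append.
Qed.

Lemma par_invR P Q : derivable T [] [P ⊙ Q] -> derivable T [] [P; Q].
Proof.
  intros H.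
  refine (d_cut (M := []) (L' := []) H _).
  apply d_negL.
  apply (d_tensorR (L := []) (L' := []) (M := [P]) (M' := [Q]));
    apply d_negR, d_id.
Qed.

(** This is where linear logic has to be affine: each branch of the [⊓] rule
    discards one of the two hypotheses. *)
Lemma pair_entails_with a b : derivable T [a; b] [a ⊓ b].
Proof.
  apply d_withR.
  - apply exchL, d_weakL, d_id.
  - apply d_weakL, d_id.
Qed.

Lemma tensor_neg_with_entails_neg a b :
  derivable T [a ⊠ (a ⊓ b)^⊥] [b^⊥].
Proof.
  apply d_tensorL, exchL, d_negL, exchR, d_negR, exchL.
  apply pair_entails_with.
Qed.

Lemma entails_with_par_neg a b :
  derivable T [a] [(a ⊓ b) ⊙ b^⊥].
Proof.
  apply d_negR, d_tensorL, d_negL, d_negL, d_negR, exchL.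
  apply pair_entails_with.
Qed.

Lemma neg_entails_tensor_neg_with a b :
  refutative T b -> derivable T [] [a ⊙ b] ->
  derivable T [b^⊥] [a ⊠ (a ⊓ b)^⊥].
Proof.
  intros ref_b total.
  apply d_negL, refutative_contractR; [exact ref_b |].
  refine (d_exch (Permutation_refl _) _
            (d_tensorR (par_invR total) (d_negR (d_withL2 a (d_id T b))))).
  apply (Permutation_cons_append [b; b]).
Qed.

Lemma with_par_neg_entails a b :
  refutative T a -> derivable T [] [a ⊙ b] ->
  derivable T [(a ⊓ b) ⊙ b^⊥] [a].
Proof.
  intros ref_a total.
  apply d_negL, exchR, refutative_contractR; [exact ref_a |].
  refine (d_exch (Permutation_refl _) _
            (d_tensorR (d_negR (d_withL1 b (d_id T a)))
               (d_negR (d_negL (exchR (par_invR total)))))).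
  apply (Permutation_cons_append [a; a]).
Qed.

End AffineSequents.

(** Transfers refutativity of the order from the generic predicate to its
    two instances [x ⊑ y] and [y ⊑ x]; it holds because [?] commutes with
    substitution. *)
Lemma refutative_subst (Sg : signature) (T : theory Sg) (D G : ctx Sg)
    (f : subst D G) (P : form D) :
  refutative T P -> refutative T (fsubst f P).
Proof.
  intros [H H']; split; [exact (d_subst f H) | exact (d_subst f H')].
Qed.

Theorem theorem8p5 :
  forall (Sg : signature) (T : theory Sg) (A : sort Sg) (R : binpred A),
  linear_order T R ->
  refutative T R ->
  let x : term [A; A] A := Var vz in
  let y : term [A; A] A := Var (vs vz) in
  equiv T (x ⊏[R] y)%aff ((x ⊑[R] y) ⊠ (x ≉[R] y))%aff /\
  equiv T (x ⊑[R] y)%aff ((x ≈[R] y) ⊙ (x ⊏[R] y))%aff.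
Proof.
  intros Sg T A R [_ total] ref_R x y.
  split; split.
  - apply neg_entails_tensor_neg_with; [now apply refutative_subst | exact total].
  - apply tensor_neg_with_entails_neg.
  - apply entails_with_par_neg.
  - apply with_par_neg_entails; [now apply refutative_subst | exact total].
Qed.
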